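(* Let $G$ be a locally compact group and let $(A,\mu)$ be a partially crossed topological $G$-module. Then $H^{1}(G,(A,\mu))$ is a topological group. In addition, if any of the following conditions is satisfied, then $H^{1}(G,(A,\mu))$ is Hausdorff: (i) $A$ is compact and $G$ has trivial center; (ii) $A$ is a trivial $G$-module; (iii) $A$ and $Z(G)$ are compact (in particular, if both topological groups $A$ and $G$ are compact).
   Context: All topological groups are assumed Hausdorff (not necessarily abelian), except that $H^{1}(G,(A,\mu))$ is not assumed to be Hausdorff. $Z(G)$ is the center of $G$. A topological $G$-module is a topological group $A$ with a continuous left action of the topological group $G$ on $A$ by group automorphisms, $(g,a)\mapsto {}^{g}a$; it is trivial if ${}^{g}a=a$ for all $g,a$. Every topological group acts on itself by conjugation: ${}^{g}h=ghg^{-1}$. A partially crossed topological $G$-module is a pair $(A,\mu)$ where $A$ is a topological $G$-module and $\mu:A\to G$ is a continuous homomorphism with $\mu({}^{g}a)=g\mu(a)g^{-1}$ for all $g\in G$, $a\in A$, and such that ${}^{\mu(a)}b=aba^{-1}$ for all $b\in A$ and all $a\in A$ with $\mu(a)\in[G,G]$ (the commutator subgroup). A crossed homomorphism is a map $\alpha:G\to A$ with $\alpha(gh)=\alpha(g)\,{}^{g}\alpha(h)$ for all $g,h\in G$. $Der_{c}(G,(A,\mu))$ is the set of pairs $(\alpha,r)$ with $\alpha:G\to A$ a continuous crossed homomorphism and $r\in G$ such that $\mu(\alpha(g))=r\,({}^{g}r)^{-1}=r(grg^{-1})^{-1}$ for all $g\in G$ (that is, $(A,\mu)$ is viewed as a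 $G-G$-bimodule, $G$ acting on itself by conjugation). It carries the subspace topology from $\mathcal{C}_{k}(G,A)\times G$, where $\mathcal{C}_{k}(G,A)$ is the set of continuous maps $G\to A$ with the compact-open topology, and the product $(\alpha,r)\star(\beta,s)=(\alpha*\beta,rs)$, where $(\alpha*\beta)(g)={}^{r}\beta(g)\,\alpha(g)$. $H^{0}(G,G)=\{r\in G: grg^{-1}=r\ \forall g\in G\}$. On $Der_{c}(G,(A,\mu))$ define $(\alpha,r)\sim(\beta,s)$ iff there is $a\in A$ with $\beta(g)=a^{-1}\alpha(g)\,{}^{g}a$ for all $g\in G$ and $s=\mu(a)^{-1}r$ mod $H^{0}(G,G)$ (i.e. $s\in\mu(a)^{-1}rH^{0}(G,G)$). This is an equivalence relation, and $H^{1}(G,(A,\mu))$ is the quotient set $Der_{c}(G,(A,\mu))/\sim$ with the quotient topology; its group structure is the one induced by $\star$, i.e. $[(\alpha,r)][(\beta,s)]=[(\alpha,r)\star(\beta,s)]$.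
   Formalization: The product on H^1 induced by ⋆ is not well defined for every partially crossed module, so the claim that H^1 is a topological group is made under the hypothesis that ⋆ induces an operation on classes; the Hausdorff claims are unconditional. *)

(* Defs.v *)
From HB Require Import structures.
From mathcomp Require Import all_boot all_classical all_reals all_analysis.

Set Implicit Arguments.
Unset Strict Implicit.
Unset Printing Implicit Defensive.

Local Open Scope classical_set_scope.
Local Open Scope quotient_scope.
Local Open Scope group_scope.

HB.mixin Record Topological_isTopologicalGroup T & Topological T & Group T := {
  mulg_continuous : continuous (fun x : T * T => x.1 * x.2) ;
  invg_continuous : continuous (fun x : T => x^-1) ;
}.

(* No separation axiom is built in. *)
#[short(type="topologicalGroupType")]
HB.structure Definition TopologicalGroup :=
  {T of Topological T & Group T & Topological_isTopologicalGroup T}.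

Definition topological_group_law (T : topologicalType) (mul : T -> T -> T) :
    Prop :=
  exists (one : T) (inv : T -> T),
    [/\ associative mul, left_id one mul /\ right_id one mul,
        left_inverse one inv mul /\ right_inverse one inv mul,
        continuous (fun x : T * T => mul x.1 x.2) & continuous inv].

Section Subgroups.
Variable G : topologicalGroupType.

Definition subgroup (H : set G) : Prop :=
  H 1 /\ forall x y, H x -> H y -> H (x * y^-1).

Definition commutator_subgroup : set G :=
  smallest subgroup [set c | exists x y, c = [~ x, y]].

Definition group_center : set G := [set z | forall g, z * g = g * z].

(* The invariants of G acting on itself by conjugation. *)
Definition H0 : set G := [set r | forall g, g * r * g^-1 = r].

Lemma commutator_subgroupP r g : commutator_subgroup (r * (g * r * g^-1)^-1).
Proof.
apply: sub_gen_smallest; exists r^-1, g^-1.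
by rewrite commgEl /conjg !invgM !invgK !mulgA.
Qed.

Lemma H0_group : subgroup H0.
Proof.
split=> [g|x y hx hy g]; first by rewrite mulg1 mulgV.
rewrite -[in RHS](hx g) -[in RHS](hy g) !invgM !invgK !mulgA.
by rewrite mulgVK.
Qed.

End Subgroups.

Arguments commutator_subgroup : clear implicits.
Arguments group_center : clear implicits.
Arguments H0 : clear implicits.

Record gmodule (G : topologicalGroupType) := GModule {
  gmodule_sort :> topologicalGroupType;
  act : G -> gmodule_sort -> gmodule_sort;
  act1 : forall a, act 1 a = a;
  actM : forall g h a, act (g * h) a = act g (act h a);
  act_mul : forall g a b, act g (a * b) = act g a * act g b;
  act_continuous :
    continuous (fun x : G * gmodule_sort => act x.1 x.2)
}.

Definition trivial_gmodule (G : topologicalGroupType) (A : gmodule G) : Prop :=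
  forall (g : G) (a : A), act g a = a.

Record partially_crossed (G : topologicalGroupType) := PartiallyCrossed {
  pc_module :> gmodule G;
  mu : pc_module -> G;
  mu_mul : forall a b, mu (a * b) = mu a * mu b;
  mu_continuous : continuous mu;
  mu_act : forall g a, mu (act g a) = g * mu a * g^-1;
  mu_peiffer : forall a b,
    commutator_subgroup G (mu a) -> act (mu a) b = a * b * a^-1
}.

Section Cohomology.
Variables (G : topologicalGroupType) (A : partially_crossed G).
Implicit Types (a b : A) (g h r s : G).

Definition crossed_hom (alpha : G -> A) : Prop :=
  forall g h, alpha (g * h) = alpha g * act g (alpha h).

Definition Der_set : set ({compact-open, G -> A} * G)%type :=
  [set p | [/\ continuous (p.1 : G -> A), crossed_hom p.1 &
    forall g, mu (p.1 g) = p.2 * (g * p.2 * g^-1)^-1]].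

(* [set_type] carries the topology induced by the inclusion. *)
Definition Der : topologicalType := set_type Der_set.

Definition der_fun (p : Der) : G -> A := (val p).1.
Definition der_elt (p : Der) : G := (val p).2.

Lemma der_continuous p : continuous (der_fun p).
Proof. by case: (set_mem (valP p)). Qed.

Lemma der_crossed p : crossed_hom (der_fun p).
Proof. by case: (set_mem (valP p)). Qed.

Lemma der_mu p g : mu (der_fun p g) = der_elt p * (g * der_elt p * g^-1)^-1.
Proof. by case: (set_mem (valP p)) => _ _ /(_ g). Qed.

Lemma mu1 : mu (1 : A) = 1.
Proof. by apply: (mulgI (mu (1 : A))); rewrite -mu_mul !mulg1. Qed.

Lemma muV a : mu a^-1 = (mu a)^-1.
Proof. by apply: (mulgI (mu a)); rewrite -mu_mul !mulgV mu1. Qed.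

Lemma act_one g : act g (1 : A) = 1.
Proof. by apply: (mulgI (act g (1 : A))); rewrite -act_mul !mulg1. Qed.

Lemma actV g a : act g a^-1 = (act g a)^-1.
Proof. by apply: (mulgI (act g a)); rewrite -act_mul !mulgV act_one. Qed.

Definition star_fun (p q : Der) : G -> A :=
  fun g => act (der_elt p) (der_fun q g) * der_fun p g.

Lemma star_subproof p q : Der_set (star_fun p q, der_elt p * der_elt q).
Proof.
split=> /= [x|g h|g].
- have cq : act (der_elt p) (der_fun q y) @[y --> x] -->
      act (der_elt p) (der_fun q x).
    have cA : act (y.1 : G) (y.2 : A) @[y --> (der_elt p, der_fun q x)] -->
        act (der_elt p) (der_fun q x) by apply: (@act_continuous G A (_, _)).
    by apply: continuous2_cvg cA _ _; [exact: cvg_cst|exact: der_continuous].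
  have mA : (y.1 : A) * (y.2 : A) @[y -->
        (act (der_elt p) (der_fun q x), der_fun p x)] -->
      act (der_elt p) (der_fun q x) * der_fun p x.
    by apply: (@mulg_continuous A (_, _)).
  exact: (continuous2_cvg _ mA cq (@der_continuous p x)).
- have pf : act (der_elt p * g) (der_fun q h) * der_fun p g =
      der_fun p g * act (g * der_elt p) (der_fun q h).
    have := @mu_peiffer _ A (der_fun p g) (act (g * der_elt p) (der_fun q h)).
    rewrite der_mu => /(_ (commutator_subgroupP _ _)); rewrite -actM.
    have -> : der_elt p * (g * der_elt p * g^-1)^-1 * (g * der_elt p) =
        der_elt p * g by rewrite !invgM invgK !mulgA !mulgVK.
    by move=> ->; rewrite mulgVK.
  rewrite /star_fun !der_crossed !act_mul -!actM.
  by rewrite -!mulgA; congr (_ * _); rewrite !mulgA pf.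
- by rewrite /star_fun mu_mul mu_act !der_mu !invgM !invgK !mulgA !mulgVK.
Qed.

Definition star (p q : Der) : Der :=
  exist (fun x => x \in Der_set) _ (mem_set (star_subproof p q)).

Definition H1_rel (p q : Der) : Prop :=
  exists a : A,
    (forall g, der_fun q g = a^-1 * der_fun p g * act g a) /\
    exists2 z, H0 G z & der_elt q = (mu a)^-1 * der_elt p * z.

Definition H1_relb : rel Der := fun p q => `[< H1_rel p q >].

Lemma H1_rel_refl : reflexive H1_relb.
Proof.
move=> p; apply/asboolP; exists 1; split=> [g|].
  by rewrite act_one invg1 mul1g mulg1.
by exists 1; [exact: (H0_group G).1|rewrite mu1 invg1 mul1g mulg1].
Qed.

Lemma H1_rel_sym : symmetric H1_relb.
Proof.
suff H p q : H1_relb p q -> H1_relb q p by move=> p q; apply/idP/idP; exact: H.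
move=> /asboolP[a [pq [z zG qp]]]; apply/asboolP; exists a^-1; split=> [g|].
  by rewrite pq invgK actV !mulgA mulgV mul1g mulgK.
exists z^-1.
  by have := (H0_group G).2 _ _ (H0_group G).1 zG; rewrite mul1g.
by rewrite qp muV invgK !mulgA mulgV mul1g mulgK.
Qed.

Lemma H1_rel_trans : transitive H1_relb.
Proof.
move=> q p t /asboolP[a [pq [z zG qp]]] /asboolP[b [qt [w wG tq]]].
apply/asboolP; exists (a * b); split=> [g|].
  by rewrite qt pq act_mul invgM !mulgA.
exists (z * w); last by rewrite tq qp mu_mul invgM !mulgA.
have wV : H0 G w^-1.
  by have := (H0_group G).2 _ _ (H0_group G).1 wG; rewrite mul1g.
by have := (H0_group G).2 _ _ zG wV; rewrite invgK.
Qed.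

Canonical H1_equiv := EquivRel H1_relb H1_rel_refl H1_rel_sym H1_rel_trans.

Definition H1 : topologicalType := quotient_topology {eq_quot H1_equiv}.

Definition H1_class (p : Der) : H1 := \pi_{eq_quot H1_equiv} p.

(* [mul] is the operation on H1 that [star] induces on classes.  It is unique
   when it exists, since every element of H1 is a class.  [H1_rel] is a congruence
   for [star] when [mu_peiffer] holds for every [a], but not in general. *)
Definition induced_by_star (mul : H1 -> H1 -> H1) : Prop :=
  forall p q, mul (H1_class p) (H1_class q) = H1_class (star p q).

End Cohomology.

(* Main.v *)
Require Import Defs.
From HB Require Import structures.
From mathcomp Require Import all_boot all_classical all_reals all_analysis.

Local Open Scope classical_set_scope.
Local Open Scope group_scope.

(** The relation on Der identifies two pairs exactly when they lie in one orbit
    of the action of A x Z(G) by gauge transformations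
      (a, z) . (alpha, r) = (g |-> a^-1 alpha(g) ^g a, mu(a)^-1 r z),
    and each transformation is continuous.  Hence the projection from Der onto
    H1 is open ([H1_class_open]), and this is what makes the topology of H1
    tractable: the square of an open surjection is again a quotient map, so a
    continuous operation on Der that respects classes induces a continuous
    operation on H1, and H1 is Hausdorff as soon as the relation is closed in
    Der x Der.

    For the first claim it remains to see that Der is a group under [star]
    with continuous operations.  Because G is locally compact and Hausdorff,
    evaluation Der x G -> A is continuous ([der_eval_continuous]); conversely
    a map into Der is continuous once its evaluation and its G-component are
    ([continuous_to_Der]).  The continuity of product, inverse and gauge
    transformations thus reduces to that of pointwise formulas in A and G.

    For the Hausdorff property, the equations that say that a transports p
    to q cut out a closed subset of A x (Der x Der), the centre of G being
    closed.  If A is compact, projecting along A preserves closedness, and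
    this settles all the compact cases at once.  If A is a trivial module,
    every mu(a) is central in G, and every value of a crossed homomorphism in
    Der is central in A by the Peiffer identity, since its image under mu is a
    commutator.  Two pairs are then equivalent iff their functions agree and
    their G-components differ by a central element, a closed condition. *)

(** * Open surjections and closed relations *)

Section OpenSurjections.
Context {X Y : topologicalType} (f : X -> Y).
Hypothesis f_open : forall x U, nbhs x U -> nbhs (f x) (f @` U).
Hypothesis f_surj : forall y, exists x, f x = y.

Lemma open_surjection_continuous (Z : topologicalType) (h : Y -> Z) :
  continuous (h \o f) -> continuous h.
Proof.
move=> hf_cont y; have [x <-] := f_surj y; move=> W /(hf_cont x) /f_open.
by apply: filterS => _ [u Wu <-].
Qed.

(** A quotient map need not have a quotient map as its square; openness is what
    survives the product. *)
Lemma open_surjection_continuous2 (Z : topologicalType) (h : Y -> Y -> Z) :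
  continuous (fun x : X * X => h (f x.1) (f x.2)) ->
  continuous (fun y : Y * Y => h y.1 y.2).
Proof.
move=> hf_cont [y1 y2].
have [x1 <-] := f_surj y1; have [x2 <-] := f_surj y2.
move=> W /(hf_cont (x1, x2)) [[U V] /= [Ux1 Vx2] UVW].
exists (f @` U, f @` V); first by split=> /=; exact: f_open.
by move=> [_ _] /= [[u Uu <-] [v Vv <-]]; exact: (UVW (u, v)).
Qed.

Lemma open_surjection_hausdorff :
  closed [set x : X * X | f x.1 = f x.2] -> hausdorff_space Y.
Proof.
move=> f_closed y1 y2.
have [x1 <-] := f_surj y1; have [x2 <-] := f_surj y2; move=> clx.
apply: (f_closed (x1, x2)) => W /= [[U V] /= [Ux1 Vx2] UVW].
have [_ [[u Uu <-] [v Vv vu]]] := clx _ _ (f_open _ _ Ux1) (f_open _ _ Vx2).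
by exists (u, v); split=> //=; exact: UVW.
Qed.

End OpenSurjections.

Lemma closed_equalizer {X T : topologicalType} (f g : X -> T) :
  hausdorff_space T -> continuous f -> continuous g ->
  closed [set x | f x = g x].
Proof.
move=> hausT f_cont g_cont x clx; apply: hausT => U V /f_cont Ufx /g_cont Vgx.
have UVx : nbhs x (f @^-1` U `&` g @^-1` V) by exact: filterI.
have [y [/= fgy [Ufy Vgy]]] := clx _ UVx.
by exists (f y); split=> //; rewrite fgy.
Qed.

(** With I := G this shows that both identities between crossed homomorphisms
    and centrality in G are closed conditions. *)
Lemma closed_equalizers {I : Type} {X T : topologicalType}
    (f g : I -> X -> T) : hausdorff_space T ->
  (forall i, continuous (f i)) -> (forall i, continuous (g i)) ->
  closed [set x | forall i, f i x = g i x].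
Proof.
move=> hausT f_cont g_cont x clx i.
apply: (closed_equalizer _ _ hausT (f_cont i) (g_cont i)).
by apply: closureS clx => y; exact.
Qed.

Lemma compact_closed_projection {K X : topologicalType} (C : set (K * X)) :
  compact [set: K] -> closed C -> closed (snd @` C).
Proof.
move=> /compact_near_coveringP cptK closedC.
rewrite -[_ @` _]setCK; apply: open_closedC; rewrite openE => x Cx.
have : \forall y \near x, [set: K] `<=` (fun k => ~ C (k, y)).
  apply: cptK => k _.
  have : nbhs (k, x) (~` C).
    apply: open_nbhs_nbhs; split; first exact: closed_openC.
    by move=> Ckx; apply: Cx; exists (k, x).
  by move=> [UV UVkx UVC]; exists UV => // -[k' x'] /UVC.
by apply: filterS => y Cy [[k z] /= Ckz zy]; apply: (Cy k I); rewrite -zy.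
Qed.

(** * Continuity of formulas in a topological group and its modules *)

Lemma continuous_mulg {T : topologicalGroupType} {X : topologicalType}
    (f g : X -> T) :
  continuous f -> continuous g -> continuous (fun x => f x * g x).
Proof.
move=> f_cont g_cont x; apply: continuous2_cvg (f_cont x) (g_cont x).
exact: (@mulg_continuous T (f x, g x)).
Qed.

Lemma continuous_invg {T : topologicalGroupType} {X : topologicalType}
    (f : X -> T) : continuous f -> continuous (fun x => (f x)^-1).
Proof.
by move=> f_cont x; apply: continuous_comp (f_cont x) (@invg_continuous _ _).
Qed.

Lemma continuous_act {G : topologicalGroupType} {A : gmodule G}
    {X : topologicalType} (f : X -> G) (h : X -> A) :
  continuous f -> continuous h -> continuous (fun x => act (f x) (h x)).
Proof.
move=> f_cont h_cont x; apply: continuous2_cvg (f_cont x) (h_cont x).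
exact: (@act_continuous G A (f x, h x)).
Qed.

Lemma continuous_const {X Y : topologicalType} (y : Y) :
  continuous (fun _ : X => y).
Proof. by move=> x; exact: cvg_cst. Qed.

Lemma continuous_pair {X Y Z : topologicalType} (f : X -> Y) (g : X -> Z) :
  continuous f -> continuous g -> continuous (fun x => (f x, g x)).
Proof.
by move=> f_cont g_cont x; apply: cvg_pair; [exact: f_cont|exact: g_cont].
Qed.

Lemma continuous_after {X Y Z : topologicalType} (g : Y -> Z) (f : X -> Y) :
  continuous g -> continuous f -> continuous (fun x => g (f x)).
Proof.
by move=> g_cont f_cont x; apply: continuous_comp; [exact: f_cont|exact: g_cont].
Qed.

Lemma continuous_fst {X Y : topologicalType} : continuous (@fst X Y).
Proof. by move=> x; exact: cvg_fst. Qed.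

Lemma continuous_snd {X Y : topologicalType} : continuous (@snd X Y).
Proof. by move=> x; exact: cvg_snd. Qed.

(** * The topological group Der *)

Section Derivations.
Context {G : topologicalGroupType} (A : partially_crossed G).
Implicit Types (p q : Der A) (g h : G) (a : A).

Lemma der_ext p q :
  (forall g, der_fun p g = der_fun q g) -> der_elt p = der_elt q -> p = q.
Proof.
move=> pq1 pq2; apply: val_inj.
rewrite [val p]surjective_pairing [val q]surjective_pairing.
by congr (_, _); [apply/funext => g; exact: pq1|exact: pq2].
Qed.

Lemma continuous_der_elt {X : topologicalType} (F : X -> Der A) :
  continuous F -> continuous (fun x => der_elt (F x)).
Proof.
apply: continuous_after (@der_elt G A) F _.
exact: (continuous_after snd (val : Der A -> _) continuous_snd
  (@initial_continuous _ _ _)).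
Qed.

Lemma der_fun_continuous :
  continuous (@der_fun G A : Der A -> {compact-open, G -> A}).
Proof.
exact: (continuous_after fst (val : Der A -> _) continuous_fst
  (@initial_continuous _ _ _)).
Qed.

(** Each function in Der is continuous, so this is the exponential law on a
    locally compact Hausdorff space. *)
Lemma der_eval_continuous : hausdorff_space G -> locally_compact [set: G] ->
  continuous (fun x : Der A * G => der_fun x.1 x.2).
Proof.
move=> hausG lcG.
have -> : (fun x : Der A * G => der_fun x.1 x.2) = uncurry (@der_fun G A).
  by apply/funext => -[].
apply: continuous_uncurry => //; first exact: der_fun_continuous.
by move=> p; exact: der_continuous.
Qed.

Lemma continuous_to_Der {X : topologicalType} (F : X -> Der A) :
  continuous (fun x : X * G => der_fun (F x.1) x.2) ->
  continuous (fun x => der_elt (F x)) -> continuous F.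
Proof.
move=> F1_cont F2_cont; apply: continuous_comp_initial.
have -> : set_val \o F =
    (fun x => (curry (fun x : X * G => der_fun (F x.1) x.2) x
                 : {compact-open, G -> A}, der_elt (F x))).
  by apply/funext => x; rewrite [LHS]surjective_pairing.
by apply: continuous_pair => //; exact: continuous_curry_fun.
Qed.

Lemma der_one_subproof : Der_set (A := A) (fun=> 1, 1).
Proof.
split=> /= [|g h|g]; first exact: continuous_const.
  by rewrite act_one mulg1.
by rewrite mu1 mulg1 mulgV invg1 mulg1.
Qed.

Definition der_one : Der A :=
  exist (fun x => x \in Der_set (A := A)) _ (mem_set der_one_subproof).

Definition der_inv_fun p : G -> A :=
  fun g => act (der_elt p)^-1 (der_fun p g)^-1.

(** As for [star], the crossed homomorphism identity needs the Peiffer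
    identity, at der_fun p g whose image under mu is a commutator. *)
Lemma der_inv_subproof p : Der_set (der_inv_fun p, (der_elt p)^-1).
Proof.
split=> /= [|g h|g].
- apply: continuous_act; first exact: continuous_const.
  by apply: continuous_invg; exact: der_continuous.
- have := @mu_peiffer _ A (der_fun p g) (act g (der_fun p h)).
  rewrite der_mu => /(_ (commutator_subgroupP _ _)) pf.
  have {}pf : act (der_elt p * g * (der_elt p)^-1) (der_fun p h) =
      der_fun p g * act g (der_fun p h) * (der_fun p g)^-1.
    by rewrite -pf -actM !invgM !invgK !mulgA mulgVK.
  rewrite /der_inv_fun der_crossed.
  have -> : act g (act (der_elt p)^-1 (der_fun p h)^-1) =
      act (der_elt p)^-1 (act (der_elt p * g * (der_elt p)^-1) (der_fun p h)^-1).
    by rewrite -!actM !mulgA mulVg mul1g.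
  by rewrite -act_mul (actV (der_elt p * _ * _)) pf !invgM !invgK !mulgA mulVg mul1g.
- rewrite /der_inv_fun mu_act muV der_mu !invgM !invgK !mulgA.
  by rewrite mulgVK.
Qed.

Definition der_inv p : Der A :=
  exist (fun x => x \in Der_set (A := A)) _ (mem_set (der_inv_subproof p)).

Lemma starA : associative (@star G A).
Proof.
move=> p q t; apply: der_ext => [g|]; last exact: mulgA.
by rewrite /der_fun /= /star_fun /= act_mul actM mulgA.
Qed.

Lemma star1p : left_id der_one (@star G A).
Proof.
move=> p; apply: der_ext => [g|]; last exact: mul1g.
by rewrite /der_fun /= /star_fun /= act1 mulg1.
Qed.

Lemma starp1 : right_id der_one (@star G A).
Proof.
move=> p; apply: der_ext => [g|]; last exact: mulg1.
by rewrite /der_fun /= /star_fun /= act_one mul1g.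
Qed.

Lemma starVp : left_inverse der_one der_inv (@star G A).
Proof.
move=> p; apply: der_ext => [g|]; last exact: mulVg.
by rewrite /der_fun /= /star_fun /= /der_inv_fun -act_mul mulgV act_one.
Qed.

Lemma starpV : right_inverse der_one der_inv (@star G A).
Proof.
move=> p; apply: der_ext => [g|]; last exact: mulgV.
by rewrite /der_fun /= /star_fun /= /der_inv_fun -actM mulgV act1 mulVg.
Qed.

(** * Gauge transformations *)

Lemma H0C z g : H0 G z -> g * z = z * g.
Proof. by move=> /(_ g) {2}<-; rewrite mulgVK. Qed.

Definition gauge_fun a p : G -> A := fun g => a^-1 * der_fun p g * act g a.

Lemma gauge_subproof a z p : H0 G z ->
  Der_set (gauge_fun a p, (mu a)^-1 * der_elt p * z).
Proof.
move=> zG; split=> /= [|g h|g].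
- apply: continuous_mulg; first apply: continuous_mulg.
  + exact: continuous_const.
  + exact: der_continuous.
  + by apply: continuous_act; [move=> x; exact: cvg_id|exact: continuous_const].
- rewrite /gauge_fun der_crossed !act_mul actV -actM !mulgA.
  by rewrite mulgK.
- rewrite /gauge_fun !mu_mul muV mu_act der_mu !invgM !invgK !mulgA.
  have zgz : z * g * z^-1 = g by rewrite -(H0C z g) // mulgK.
  rewrite -(mulgA _ z g) -(mulgA _ (z * g)) zgz.
  by rewrite mulgVK.
Qed.

Definition gauge a z (zG : H0 G z) p : Der A :=
  exist (fun x => x \in Der_set (A := A)) _ (mem_set (gauge_subproof a z p zG)).

Lemma H1_classP p q : H1_class p = H1_class q <-> H1_rel p q.
Proof.
split=> [/eqmodP /asboolP|pq]; first by [].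
by apply/eqmodP/asboolP.
Qed.

Lemma H1_class_surj (x : H1 A) : exists p, H1_class p = x.
Proof. by exists (repr x); exact: reprK. Qed.

Lemma H1_class_gauge a z (zG : H0 G z) p :
  H1_class (gauge a z zG p) = H1_class p.
Proof. by apply/esym/H1_classP; exists a; split=> //; exists z. Qed.

Lemma H1_rel_gauge p q :
  H1_rel p q -> exists a z (zG : H0 G z), q = gauge a z zG p.
Proof.
by move=> [a [pq [z zG qp]]]; exists a, z, zG; apply: der_ext.
Qed.

Hypotheses (hausG : hausdorff_space G) (lcG : locally_compact [set: G]).

Lemma continuous_der_eval {X : topologicalType} (F : X -> Der A) (k : X -> G) :
  continuous F -> continuous k -> continuous (fun x => der_fun (F x) (k x)).
Proof.
move=> F_cont k_cont.
exact: (continuous_after (fun x : Der A * G => der_fun x.1 x.2) _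
  (der_eval_continuous hausG lcG) (continuous_pair F k F_cont k_cont)).
Qed.

Lemma star_continuous : continuous (fun x : Der A * Der A => star x.1 x.2).
Proof.
apply: continuous_to_Der; last first.
  apply: continuous_mulg; apply: continuous_der_elt.
    exact: continuous_fst.
  exact: continuous_snd.
have c1 : continuous (fun x : Der A * Der A * G => x.1.1).
  exact: (continuous_after fst fst continuous_fst continuous_fst).
have c2 : continuous (fun x : Der A * Der A * G => x.1.2).
  exact: (continuous_after snd fst continuous_snd continuous_fst).
apply: continuous_mulg; first apply: continuous_act.
- exact: continuous_der_elt.
- exact: continuous_der_eval c2 continuous_snd.
- exact: continuous_der_eval c1 continuous_snd.
Qed.

Lemma der_inv_continuous : continuous der_inv.
Proof.
apply: continuous_to_Der; last first.
  by apply: continuous_invg; apply: (continuous_der_elt id) => p; exact: cvg_id.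
apply: continuous_act; apply: continuous_invg.
  by apply: continuous_der_elt; exact: continuous_fst.
exact: continuous_der_eval continuous_fst continuous_snd.
Qed.

Lemma gauge_continuous a z (zG : H0 G z) : continuous (gauge a z zG).
Proof.
apply: continuous_to_Der; last first.
  apply: continuous_mulg; last exact: continuous_const.
  apply: continuous_mulg; first exact: continuous_const.
  by apply: (continuous_der_elt id) => p; exact: cvg_id.
apply: continuous_mulg; first apply: continuous_mulg.
- exact: continuous_const.
- exact: continuous_der_eval continuous_fst continuous_snd.
- by apply: continuous_act; [exact: continuous_snd|exact: continuous_const].
Qed.

(** The saturation of an open set is the union of its preimages under the
    gauge transformations, which are continuous. *)
Lemma H1_class_open p (U : set (Der A)) :
  nbhs p U -> nbhs (H1_class p) ((@H1_class G A) @` U).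
Proof.
rewrite nbhsE => -[V [oV Vp] VU].
apply: (@filterS _ _ _ (@H1_class G A @` V)); first exact: image_subset.
apply: open_nbhs_nbhs; split; last by exists p.
rewrite /open /= /quotient_open openE => q /= [v Vv vq].
have [a [z [zG vE]]] := H1_rel_gauge _ _ ((H1_classP _ _).1 (esym vq)).
have : nbhs q (gauge a z zG @^-1` V).
  apply: gauge_continuous; rewrite -vE; exact: open_nbhs_nbhs.
apply: filterS => t Vt; exists (gauge a z zG t) => //.
exact: H1_class_gauge.
Qed.

End Derivations.

(** * The group law and the Hausdorff property of H1 *)

Section FirstCohomology.
Context {G : topologicalGroupType} (A : partially_crossed G).
Hypotheses (hausG : hausdorff_space G) (lcG : locally_compact [set: G]).

(** The inverse is chosen on representatives; that the class of [der_inv p]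
    depends only on the class of [p] is the uniqueness of inverses for [mul]. *)
Lemma H1_topological_group (mul : H1 A -> H1 A -> H1 A) :
  induced_by_star mul -> topological_group_law mul.
Proof.
move=> mulE; pose inv (x : H1 A) : H1 A := H1_class (der_inv A (repr x)).
have mulA : associative mul.
  move=> x y z; have [p <-] := H1_class_surj A x.
  have [q <-] := H1_class_surj A y; have [t <-] := H1_class_surj A z.
  by rewrite !mulE starA.
have mul1 : left_id (H1_class (der_one A)) mul.
  by move=> x; have [p <-] := H1_class_surj A x; rewrite mulE star1p.
have mulr1 : right_id (H1_class (der_one A)) mul.
  by move=> x; have [p <-] := H1_class_surj A x; rewrite mulE starp1.
have mulV : left_inverse (H1_class (der_one A)) inv mul.
  move=> x; have {2}<- : H1_class (repr x) = x by exact: reprK.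
  by rewrite mulE starVp.
have mulrV : right_inverse (H1_class (der_one A)) inv mul.
  move=> x; have {1}<- : H1_class (repr x) = x by exact: reprK.
  by rewrite mulE starpV.
have invE p : inv (H1_class p) = H1_class (der_inv A p).
  by rewrite -[LHS]mulr1 -(starpV A p) -mulE mulA mulV mul1.
exists (H1_class (der_one A)), inv; split=> //.
- apply: (open_surjection_continuous2 (@H1_class G A)).
  + exact: H1_class_open.
  + exact: H1_class_surj.
  + have -> : (fun x => mul (H1_class x.1) (H1_class x.2)) =
        @H1_class G A \o (fun x => star x.1 x.2).
      by apply/funext => x; exact: mulE.
    exact: (continuous_after (@H1_class G A) _ (@pi_continuous _ _)
      (star_continuous A hausG lcG)).
- apply: (open_surjection_continuous (@H1_class G A)).
  + exact: H1_class_open.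
  + exact: H1_class_surj.
  + have -> : inv \o @H1_class G A = @H1_class G A \o der_inv A.
      by apply/funext => p; exact: invE.
    exact: (continuous_after (@H1_class G A) _ (@pi_continuous _ _)
      (der_inv_continuous A hausG lcG)).
Qed.

Lemma H1_hausdorff : closed [set x : Der A * Der A | H1_rel x.1 x.2] ->
  hausdorff_space (H1 A).
Proof.
move=> rel_closed; apply: (open_surjection_hausdorff (@H1_class G A)).
- exact: H1_class_open.
- exact: H1_class_surj.
- by congr closed : rel_closed; apply/seteqP; split=> x /H1_classP.
Qed.

Lemma closed_preimage_H0 {X : topologicalType} (f : X -> G) :
  continuous f -> closed [set x | H0 G (f x)].
Proof.
move=> f_cont; apply: closed_equalizers => // g.
apply: continuous_mulg; last exact: continuous_const.
by apply: continuous_mulg => //; exact: continuous_const.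
Qed.

(** Membership of z in the centre is expressed by its value
    (mu(a)^-1 r)^-1 s, which leaves a as the only existential. *)
Lemma H1_relE (p q : Der A) : H1_rel p q <-> exists a : A,
  (forall g, der_fun q g = a^-1 * der_fun p g * act g a) /\
  H0 G (((mu a)^-1 * der_elt p)^-1 * der_elt q).
Proof.
split=> -[a [pq]] => [[z zG ->]|zG]; exists a; split=> //.
  by rewrite mulKg.
by exists (((mu a)^-1 * der_elt p)^-1 * der_elt q); rewrite ?mulVKg.
Qed.

Hypothesis hausA : hausdorff_space A.

Lemma H1_hausdorff_compact : compact [set: A] -> hausdorff_space (H1 A).
Proof.
move=> cptA; apply: H1_hausdorff.
pose C : set (A * (Der A * Der A)) := [set x |
  (forall g, der_fun x.2.2 g = x.1^-1 * der_fun x.2.1 g * act g x.1) /\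
  H0 G (((mu x.1)^-1 * der_elt x.2.1)^-1 * der_elt x.2.2)].
have -> : [set x : Der A * Der A | H1_rel x.1 x.2] = snd @` C.
  apply/seteqP; split=> [[p q] /= /H1_relE [a pq]|_ [[a [p q]] pq <-]].
    by exists (a, (p, q)).
  by apply/H1_relE; exists a.
have ca : continuous (fun x : A * (Der A * Der A) => x.1).
  exact: continuous_fst.
have cp : continuous (fun x : A * (Der A * Der A) => x.2.1).
  exact: (continuous_after fst snd continuous_fst continuous_snd).
have cq : continuous (fun x : A * (Der A * Der A) => x.2.2).
  exact: (continuous_after snd snd continuous_snd continuous_snd).
apply: compact_closed_projection => //; apply: closedI.
  apply: closed_equalizers => // g.
    by apply: continuous_der_eval => //; exact: continuous_const.
  apply: continuous_mulg; first apply: continuous_mulg.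
  - exact: continuous_invg.
  - by apply: continuous_der_eval => //; exact: continuous_const.
  - by apply: continuous_act => //; exact: continuous_const.
apply: closed_preimage_H0; apply: continuous_mulg.
  apply: continuous_invg; apply: continuous_mulg.
    apply: continuous_invg.
    exact: (continuous_after (@mu G A) _ (@mu_continuous _ A) ca).
  exact: continuous_der_elt.
exact: continuous_der_elt.
Qed.

Lemma trivial_mu_central (a : A) : trivial_gmodule A -> H0 G (mu a).
Proof. by move=> trivA g; rewrite -mu_act trivA. Qed.

Lemma trivial_der_central (p : Der A) (g : G) (b : A) : trivial_gmodule A ->
  b * der_fun p g = der_fun p g * b.
Proof.
move=> trivA; have := @mu_peiffer _ A (der_fun p g) b.
rewrite der_mu trivA => /(_ (commutator_subgroupP _ _)) {1}->.
by rewrite mulgVK.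
Qed.

Lemma trivial_H1_relE (p q : Der A) : trivial_gmodule A ->
  H1_rel p q <->
  (forall g, der_fun p g = der_fun q g) /\ H0 G ((der_elt p)^-1 * der_elt q).
Proof.
move=> trivA; split=> [/H1_relE [a [pq zG]]|[pq zG]].
  split=> [g|].
    by rewrite pq trivA trivial_der_central // mulgVK.
  have aG := trivial_mu_central a trivA.
  have := (H0_group G).2 _ _ zG aG.
  by rewrite invgM invgK -(mulgA _ (mu a)) -(H0C _ (der_elt q) aG) mulgA mulgK.
apply/H1_relE; exists 1.
by split=> [g|]; rewrite ?mu1 ?invg1 ?mul1g // trivA mulg1.
Qed.

Lemma H1_hausdorff_trivial : trivial_gmodule A -> hausdorff_space (H1 A).
Proof.
move=> trivA; apply: H1_hausdorff.
have -> : [set x : Der A * Der A | H1_rel x.1 x.2] =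
    [set x | forall g, der_fun x.1 g = der_fun x.2 g] `&`
    [set x | H0 G ((der_elt x.1)^-1 * der_elt x.2)].
  by apply/seteqP; split=> x /trivial_H1_relE; exact.
apply: closedI.
  apply: closed_equalizers => // g; apply: continuous_der_eval => //;
    [exact: continuous_fst|exact: continuous_const|
     exact: continuous_snd|exact: continuous_const].
apply: closed_preimage_H0; apply: continuous_mulg; first apply: continuous_invg.
  by apply: continuous_der_elt; exact: continuous_fst.
by apply: continuous_der_elt; exact: continuous_snd.
Qed.

End FirstCohomology.

Theorem theorem3p4 (G : topologicalGroupType) (A : partially_crossed G)
    (hausG : hausdorff_space G) (hausA : hausdorff_space A)
    (lcG : locally_compact [set: G]) :
  (forall mul : H1 A -> H1 A -> H1 A,
      induced_by_star mul -> topological_group_law mul)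
  /\
  [/\ compact [set: A] -> group_center G = [set 1] -> hausdorff_space (H1 A),
      trivial_gmodule A -> hausdorff_space (H1 A),
      compact [set: A] -> compact (group_center G) -> hausdorff_space (H1 A)
    & compact [set: A] -> compact [set: G] -> hausdorff_space (H1 A)].
Proof.
split; first exact: H1_topological_group.
split=> [cptA _||cptA _|cptA _]; [|exact: H1_hausdorff_trivial| |];
  exact: H1_hausdorff_compact.
Qed.
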